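(* Let $h(y)$ be a delta series and $l(y)$ an invertible series over $\mathbb{C}$, and let $\{{}_sA_n(x)\}_{n\ge 0}$ be the Sheffer-Appell polynomial sequence for the pair $(l(y),h(y))$. Then for every integer $n\ge 0$ the polynomial ${}_sA_n(x)$ satisfies the differential equation $$\sum_{k=0}^{n}(x a_k+b_k+c_k)\,\frac{{}_sA_n^{(k)}(x)}{k!}-n\,{}_sA_n(x)=0,$$ where, for $k\ge 0$, $$a_k=\left(\frac{h(y)}{h'(y)}\right)^{(k)}\Bigg|_{y=0},\qquad b_k=\left(-\frac{h(y)\,l'(h(y))}{l(h(y))}\right)^{(k)}\Bigg|_{y=0},\qquad c_k=\left(-\frac{h(y)\,l'(y)}{h'(y)\,l(y)}\right)^{(k)}\Bigg|_{y=0}.$$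
   Context: All series are power series in $y$ over $\mathbb{C}$, of the form $\sum_{r\ge 0}\alpha_r y^r/r!$. A delta series is a power series $h(y)$ with $h(0)=0$ and $h'(0)\neq 0$; an invertible series is a power series $l(y)$ with $l(0)\neq 0$. $h^{-1}(y)$ denotes the compositional inverse of $h(y)$, i.e. $h^{-1}(h(y))=h(h^{-1}(y))=y$. The Sheffer-Appell polynomial sequence $\{{}_sA_n(x)\}_{n\ge0}$ for the pair $(l(y),h(y))$, written ${}_sA_n(x)\sim(l(y),h(y))$, is defined by the generating function $$\frac{1}{l(h^{-1}(y))\,l(y)}\,e^{x h^{-1}(y)}=\sum_{n=0}^{\infty}{}_sA_n(x)\,\frac{y^n}{n!}.$$ For a series $g(y)$, $(g(y))^{(k)}|_{y=0}$ denotes its $k$th derivative with respect to $y$ evaluated at $y=0$; $l'(h(y))$ means $l'$ evaluated at $h(y)$. ${}_sA_n^{(k)}(x)$ is the $k$th derivative of ${}_sA_n(x)$ with respect to $x$. *)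

(* Defs.v *)
(* Formal power series in one variable y over a ring, their
   ring structure and composition, and the Sheffer-Appell sequence of a pair
   (l, h) of such series. *)
From HB Require Import structures.
From mathcomp Require Import all_boot all_order all_algebra.
From mathcomp Require Import boolp classical_sets reals.
From mathcomp Require Export complex.

Set Implicit Arguments.
Unset Strict Implicit.
Unset Printing Implicit Defensive.

Import GRing.Theory.
Local Open Scope ring_scope.

(* [f n] is the ordinary coefficient of y^n: in the exponential form
   \sum_r alpha_r y^r / r! of the same series, alpha_r = r! * f r. *)
Record fps (R : Type) := Fps { fps_coef :> nat -> R }.
Arguments Fps {R} _.

HB.instance Definition _ (R : Type) := gen_eqMixin (fps R).
HB.instance Definition _ (R : Type) := gen_choiceMixin (fps R).

Lemma fpsP (R : Type) (f g : fps R) : (forall n, f n = g n) -> f = g.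
Proof. by case: f => f; case: g => g /= fg; congr Fps; apply/funext. Qed.

Section Zmodule.
Variable R : zmodType.
Implicit Types f g : fps R.

Definition fps_zero : fps R := Fps (fun _ => 0).
Definition fps_opp f : fps R := Fps (fun n => - f n).
Definition fps_add f g : fps R := Fps (fun n => f n + g n).

Lemma fps_addA : associative fps_add.
Proof. by move=> f g h; apply: fpsP => n /=; rewrite addrA. Qed.

Lemma fps_addC : commutative fps_add.
Proof. by move=> f g; apply: fpsP => n /=; rewrite addrC. Qed.

Lemma fps_add0 : left_id fps_zero fps_add.
Proof. by move=> f; apply: fpsP => n /=; rewrite add0r. Qed.

Lemma fps_addN : left_inverse fps_zero fps_opp fps_add.
Proof. by move=> f; apply: fpsP => n /=; rewrite addNr. Qed.

HB.instance Definition _ :=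
  GRing.isZmodule.Build (fps R) fps_addA fps_addC fps_add0 fps_addN.

Lemma coef0S n : (0 : fps R) n = 0. Proof. by []. Qed.
Lemma coefDS f g n : (f + g) n = f n + g n. Proof. by []. Qed.
Lemma coefNS f n : (- f) n = - f n. Proof. by []. Qed.
Lemma coefBS f g n : (f - g) n = f n - g n. Proof. by []. Qed.

Lemma coef_sumS (I : Type) (r : seq I) (P : pred I) (F : I -> fps R) n :
  (\sum_(i <- r | P i) F i) n = \sum_(i <- r | P i) F i n.
Proof. by elim/big_rec2: _ => // i x y _ <-. Qed.

End Zmodule.

Section Ring.
Variable R : nzRingType.
Implicit Types f g h : fps R.

Definition fpsC (c : R) : fps R := Fps (fun n => if n == 0%N then c else 0).
Definition fps_mul f g : fps R :=
  Fps (fun n => \sum_(i < n.+1) f i * g (n - i)%N).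

Let trunc N f : {poly R} := \poly_(i < N) f i.

Let fps_mul_trunc f g n N : (n < N)%N ->
  fps_mul f g n = (trunc N f * trunc N g)`_n.
Proof.
move=> ltnN; rewrite coefM; apply: eq_bigr => i _; rewrite !coef_poly.
by rewrite (leq_ltn_trans (leq_ord i) ltnN) (leq_ltn_trans (leq_subr _ _) ltnN).
Qed.

Lemma fps_mulA : associative fps_mul.
Proof.
move=> f g h; apply: fpsP => n.
have tS i k : (i < n.+1)%N -> (trunc n.+1 k)`_i = k i.
  by move=> lti; rewrite coef_poly lti.
transitivity ((trunc n.+1 f * trunc n.+1 g * trunc n.+1 h)`_n).
  rewrite -mulrA coefM; apply: eq_bigr => i _; rewrite tS //.
  by rewrite (@fps_mul_trunc g h _ n.+1) // ltnS leq_subr.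
rewrite coefM; apply: eq_bigr => i _.
by rewrite tS ?ltnS ?leq_subr // -fps_mul_trunc.
Qed.

Lemma fps_mul1 : left_id (fpsC 1) fps_mul.
Proof.
move=> f; apply: fpsP => n /=.
by rewrite big_ord_recl subn0 mul1r big1 ?addr0 // => i _; rewrite mul0r.
Qed.

Lemma fps_mulr1 : right_id (fpsC 1) fps_mul.
Proof.
move=> f; apply: fpsP => n /=; rewrite big_ord_recr /= subnn mulr1 big1 ?add0r //.
by move=> i _; rewrite subn_eq0 leqNgt ltn_ord mulr0.
Qed.

Lemma fps_mulDl : left_distributive fps_mul (@fps_add R).
Proof.
move=> f g h; apply: fpsP => n /=.
by rewrite -big_split; apply: eq_bigr => i _; rewrite mulrDl.
Qed.

Lemma fps_mulDr : right_distributive fps_mul (@fps_add R).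
Proof.
move=> f g h; apply: fpsP => n /=.
by rewrite -big_split; apply: eq_bigr => i _; rewrite mulrDr.
Qed.

Lemma fps_oner_neq0 : fpsC 1 != 0.
Proof. by apply/eqP => /(congr1 (fun f : fps R => f 0%N))/eqP; rewrite oner_eq0. Qed.

HB.instance Definition _ := GRing.Zmodule_isNzRing.Build (fps R)
  fps_mulA fps_mul1 fps_mulr1 fps_mulDl fps_mulDr fps_oner_neq0.

Lemma coefCS c n : fpsC c n = if n == 0%N then c else 0. Proof. by []. Qed.
Lemma coef1S n : (1 : fps R) n = if n == 0%N then 1 else 0. Proof. by []. Qed.
Lemma coefMS f g n : (f * g) n = \sum_(i < n.+1) f i * g (n - i)%N.
Proof. by []. Qed.

Definition fpsX : fps R := Fps (fun n => (n == 1%N)%:R).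
Definition fps_deriv f : fps R := Fps (fun n => f n.+1 *+ n.+1).

(* Substitution f(g(y)). When g(0) = 0 the powers g^k with k > n do not
   contribute to the coefficient of y^n; when g(0) <> 0 the value is junk. *)
Definition fps_comp f g : fps R :=
  Fps (fun n => \sum_(k < n.+1) f k * (g ^+ k) n).

Lemma coef_expS_small f k n : f 0%N = 0 -> (n < k)%N -> (f ^+ k) n = 0.
Proof.
move=> f0; elim: k n => // k IHk n ltnk.
rewrite exprS coefMS big_ord_recl f0 mul0r add0r big1 // => i _.
rewrite IHk ?mulr0 // lift0; case: n i ltnk => [[]//|n] i ltnk.
by rewrite subSS (leq_ltn_trans (leq_subr _ _)).
Qed.

End Ring.

Arguments fpsX {R}.
Notation "f \oS g" := (fps_comp f g) (at level 50, left associativity) : ring_scope.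
Notation "f ^`S" := (fps_deriv f) (at level 2, format "f ^`S") : ring_scope.

Section ComRing.
Variable R : comNzRingType.

Lemma fps_mulC : commutative (@fps_mul R).
Proof.
move=> f g; apply: fpsP => n /=; rewrite (reindex_inj rev_ord_inj) /=.
by apply: eq_bigr => i _; rewrite mulrC subSS subKn ?leq_ord.
Qed.

HB.instance Definition _ := GRing.PzRing_hasCommutativeMul.Build (fps R) fps_mulC.

End ComRing.

Section UnitRing.
Variable R : comUnitRingType.
Implicit Types f g : fps R.

Definition fps_unit : pred (fps R) := fun f => f 0%N \is a GRing.unit.

(* With c = f(0)^-1, the inverse is c / (1 - u) for u = 1 - c f, u(0) = 0. *)
Definition fps_inv f : fps R :=
  if fps_unit f then
    fpsC (f 0%N)^-1 * (Fps (fun _ => 1) \oS (1 - fpsC (f 0%N)^-1 * f))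
  else f.

Lemma fps_mulVf : {in fps_unit, left_inverse 1 fps_inv *%R}.
Proof.
move=> f Uf; have {}Uf : f 0%N \is a GRing.unit by [].
rewrite /fps_inv /fps_unit Uf.
set c := fpsC _; set u := 1 - c * f.
have u0 : u 0%N = 0.
  by rewrite coefBS coefMS big_ord1 subnn coefCS mulVr ?subrr.
rewrite mulrAC; have -> : c * f = 1 - u by rewrite /u opprB addrC subrK.
apply: fpsP => n.
pose s := \sum_(k < n.+1) u ^+ k.
have sE i : (i < n.+1)%N -> (Fps (fun _ => 1) \oS u) i = s i.
  move=> ltin; rewrite /s coef_sumS /=.
  rewrite (big_ord_widen _ (fun k => 1 * (u ^+ k) i) ltin) big_mkcond.
  apply: eq_bigr => k _; rewrite mul1r; case: ifP => // /negbT.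
  by rewrite -leqNgt => ltik; rewrite coef_expS_small.
transitivity (((1 - u) * s) n).
  by rewrite !coefMS; apply: eq_bigr => i _; rewrite sE // ltnS leq_subr.
by rewrite /s -opprB mulNr -subrX1 opprB coefBS coef_expS_small ?subr0.
Qed.

Lemma fps_unitPl f g : g * f = 1 -> fps_unit f.
Proof.
move=> /(congr1 (fun h : fps R => h 0%N)); rewrite coefMS big_ord1 subnn => gf1.
by apply/unitrPr; exists (g 0%N); rewrite mulrC.
Qed.

Lemma fps_inv_out : {in [predC fps_unit], fps_inv =1 id}.
Proof. by move=> f; rewrite /fps_inv => /negPf; rewrite /in_mem /= => ->. Qed.

HB.instance Definition _ := GRing.ComNzRing_hasMulInverse.Build (fps R)
  fps_mulVf fps_unitPl fps_inv_out.

Lemma fps_unitE f : (f \is a GRing.unit) = (f 0%N \is a GRing.unit).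
Proof. by []. Qed.

Definition fps_exp : fps R := Fps (fun n => (n`!%:R)^-1).

End UnitRing.

Arguments fps_exp {R}.

Definition fps_map (R S : Type) (phi : R -> S) (f : fps R) : fps S :=
  Fps (fun n => phi (f n)).

Definition fps_derivn_at0 (R : nzRingType) (k : nat) (f : fps R) : R :=
  iter k (@fps_deriv R) f 0%N.

Section Sheffer.
Variable F : fieldType.
Implicit Types l h : fps F.

Definition delta_series h : Prop := h 0%N = 0 /\ h^`S 0%N != 0.
Definition invertible_series l : Prop := l 0%N != 0.

(* The g with g(h(y)) = h(g(y)) = y; it exists and is unique as soon as h is
   a delta series. The condition g(0) = 0 makes the substitution into h
   meaningful. *)
Definition fps_cinv h : fps F :=
  xget 0 [set g : fps F | [/\ g 0%N = 0, g \oS h = fpsX & h \oS g = fpsX]].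

(* An identity of power series in y over F[x]; in [fpsC 'X] the variable 'X
   is x. *)
Definition sheffer_appell l h (A : nat -> {poly F}) : Prop :=
  fps_map polyC (((l \oS fps_cinv h) * l)^-1) *
    (fps_map polyC fps_exp \oS (fpsC 'X * fps_map polyC (fps_cinv h)))
  = Fps (fun n => (n`!%:R)^-1 *: A n).

Definition sheffer_a h k : F := fps_derivn_at0 k (h / h^`S).
Definition sheffer_b l h k : F :=
  fps_derivn_at0 k (- ((h * (l^`S \oS h)) / (l \oS h))).
Definition sheffer_c l h k : F :=
  fps_derivn_at0 k (- ((h * l^`S) / (h^`S * l))).

End Sheffer.

(* Main.v *)
(* With f = h^-1, the generating function G satisfies
   y dG/dy = x (y f') G - (y f' l'(f) / l(f)) G - (y l' / l) G and
   dG/dx = f G. As h(f(y)) = y, all the coefficients on the right are of the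
   form s(f(y)) with s in turn h/h', - h l' / (h' l) and - h l'(h) / l(h), so
   that multiplication by s(f(y)) is the operator s(d/dx) on G. The
   coefficient of y^n is the stated equation, where s(d/dx) is cut at order n
   because f^k G has order at least k in y. *)
Require Import Defs.
From HB Require Import structures.
From mathcomp Require Import all_boot all_order all_algebra.
From mathcomp Require Import classical_sets reals complex.
From mathcomp Require Import ring.

Set Implicit Arguments.
Unset Strict Implicit.
Unset Printing Implicit Defensive.

Import GRing.Theory Num.Theory.
Local Open Scope ring_scope.

(** * Constants and coefficient maps as ring morphisms *)

Section Maps.
Variables R S : nzRingType.

Lemma fpsC_is_zmod_morphism : zmod_morphism (@fpsC R).
Proof.
by move=> a b; apply: fpsP => n; rewrite coefBS !coefCS; case: eqP; rewrite ?subrr.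
Qed.

Lemma coefCM (c : R) (f : fps R) n : (fpsC c * f) n = c * f n.
Proof.
by rewrite coefMS big_ord_recl subn0 big1 ?addr0 // => i _; rewrite mul0r.
Qed.

Lemma fpsC_is_monoid_morphism : monoid_morphism (@fpsC R).
Proof.
split=> // a b; apply: fpsP => n; rewrite coefCM !coefCS.
by case: eqP; rewrite ?mulr0.
Qed.

HB.instance Definition _ :=
  GRing.isZmodMorphism.Build R (fps R) (@fpsC R) fpsC_is_zmod_morphism.
HB.instance Definition _ :=
  GRing.isMonoidMorphism.Build R (fps R) (@fpsC R) fpsC_is_monoid_morphism.

Variable phi : {rmorphism R -> S}.

Lemma fps_map_is_zmod_morphism : zmod_morphism (fps_map phi).
Proof. by move=> f g; apply: fpsP => n /=; rewrite rmorphB. Qed.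

Lemma fps_map_is_monoid_morphism : monoid_morphism (fps_map phi).
Proof.
split=> [|f g]; apply: fpsP => n /=; first by case: eqP; rewrite ?rmorph1 ?rmorph0.
by rewrite rmorph_sum; apply: eq_bigr => i _; rewrite rmorphM.
Qed.

HB.instance Definition _ := GRing.isZmodMorphism.Build (fps R) (fps S)
  (fps_map phi) fps_map_is_zmod_morphism.
HB.instance Definition _ := GRing.isMonoidMorphism.Build (fps R) (fps S)
  (fps_map phi) fps_map_is_monoid_morphism.

Lemma fps_map_comp (f g : fps R) :
  fps_map phi (f \oS g) = fps_map phi f \oS fps_map phi g.
Proof.
apply: fpsP => n /=; rewrite rmorph_sum; apply: eq_bigr => k _.
by rewrite rmorphM -rmorphXn.
Qed.

End Maps.

Lemma coefXMS (R : nzRingType) (f : fps R) n :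
  (fpsX * f) n = if n is m.+1 then f m else 0.
Proof.
case: n => [|n]; rewrite coefMS big_ord_recl mul0r add0r ?big_ord0 //.
rewrite big_ord_recl /= mul1r subSS subn0 big1 ?addr0 // => i _.
by rewrite mul0r.
Qed.

Lemma fps_derivn_at0E (R : nzRingType) k (f : fps R) :
  fps_derivn_at0 k f = f k *+ k`!.
Proof.
rewrite /fps_derivn_at0.
(* The induction on [k] needs every coefficient, not only the constant one. *)
suff /(_ 0%N): forall n, iter k (@fps_deriv R) f n = f (n + k)%N *+ (n + k) ^_ k.
  by rewrite add0n ffactnn.
elim: k => [|k IHk] n; first by rewrite addn0 ffactn0.
by rewrite iterS /= IHk addSnnS -mulrnA ffactnSr -addSnnS addnK.
Qed.

(** * Substitution of a series without constant term *)

Section Composition.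
Variable R : comNzRingType.
Implicit Types f g h w : fps R.

Lemma eq_coefMS f1 f2 g1 g2 n :
    (forall i, (i <= n)%N -> f1 i = f2 i) ->
    (forall i, (i <= n)%N -> g1 i = g2 i) ->
  (f1 * g1) n = (f2 * g2) n.
Proof.
move=> f12 g12; rewrite !coefMS; apply: eq_bigr => i _.
by rewrite f12 ?g12 ?leq_subr ?leq_ord.
Qed.

Lemma coef_expM_small g w k n : g 0%N = 0 -> (n < k)%N -> (g ^+ k * w) n = 0.
Proof.
move=> g0 ltnk; rewrite coefMS big1 // => i _.
by rewrite coef_expS_small ?mul0r // (leq_trans _ ltnk).
Qed.

(** The powers of [g] beyond n vanish at y^n, so one bound [N] serves all coefficients below it and
    composition becomes the evaluation of a polynomial. *)
Lemma fps_comp_trunc f g n N : g 0%N = 0 -> (n < N)%N ->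
  (f \oS g) n = (\sum_(k < N) fpsC (f k) * g ^+ k) n.
Proof.
move=> g0 ltnN; rewrite coef_sumS [LHS]/=.
rewrite (big_ord_widen _ (fun k => f k * (g ^+ k) n) ltnN) big_mkcond.
apply: eq_bigr => k _; rewrite coefCM.
by case: ltnP => // ltnk; rewrite coef_expS_small ?mulr0.
Qed.

(** This will cut s(d/dx) at order n: [g ^+ k * w] has order at least k. *)
Lemma coef_fps_compM f g w n : g 0%N = 0 ->
  ((f \oS g) * w) n = \sum_(k < n.+1) f k * (g ^+ k * w) n.
Proof.
move=> g0; rewrite (@eq_coefMS _ (\sum_(k < n.+1) fpsC (f k) * g ^+ k) _ w) //.
  rewrite mulr_suml coef_sumS; apply: eq_bigr => k _.
  by rewrite -mulrA coefCM.
by move=> i lein; apply: fps_comp_trunc.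
Qed.

Lemma fps_compC c g : fpsC c \oS g = fpsC c.
Proof.
apply: fpsP => n /=; rewrite big_ord_recl expr0 /= big1 ?addr0 => [|i _].
  by case: eqP => _; rewrite ?mulr1 ?mulr0.
by rewrite mul0r.
Qed.

Lemma fps_comp1 g : 1 \oS g = 1.
Proof. exact: fps_compC. Qed.

Lemma fps_compD f1 f2 g : (f1 + f2) \oS g = (f1 \oS g) + (f2 \oS g).
Proof.
apply: fpsP => n /=; rewrite -big_split.
by apply: eq_bigr => k _; rewrite mulrDl.
Qed.

Lemma fps_compN f g : (- f) \oS g = - (f \oS g).
Proof.
by apply: fpsP => n /=; rewrite -sumrN; apply: eq_bigr => k _; rewrite mulNr.
Qed.

(** Up to y^n, substitution is evaluation at [g] of the truncated polynomial, and evaluation is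
    multiplicative. *)
Lemma fps_compM f1 f2 g : g 0%N = 0 ->
  (f1 * f2) \oS g = (f1 \oS g) * (f2 \oS g).
Proof.
move=> g0; apply: fpsP => n.
pose t f : {poly R} := \poly_(k < n.+1) f k.
pose ev (p : {poly R}) := (map_poly (@fpsC R) p).[g].
have evE f i : (i <= n)%N -> (f \oS g) i = ev (t f) i.
  move=> lein; rewrite (@fps_comp_trunc _ _ _ n.+1) //.
  rewrite /ev (@horner_coef_wide _ n.+1).
    congr (fps_coef _ i); apply: eq_bigr => k _.
    by rewrite coef_map coef_poly ltn_ord.
  by rewrite (leq_trans (size_poly _ _)) ?size_poly.
have tM : t (f1 * f2) = take_poly n.+1 (t f1 * t f2).
  apply/polyP => k; rewrite coef_take_poly coef_poly; case: ifP => // ltkn.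
  rewrite coefM coefMS; apply: eq_bigr => i _; rewrite !coef_poly.
  by rewrite (leq_ltn_trans (leq_ord i) ltkn) (leq_ltn_trans (leq_subr _ _) ltkn).
rewrite (eq_coefMS (evE f1) (evE f2)) evE // tM.
(* The part of the product dropped by truncation is a multiple of 'X^n.+1; its value is a multiple
   of [g ^+ n.+1], invisible at y^n. *)
rewrite -hornerM -rmorphM -[in RHS](poly_take_drop n.+1 (t f1 * t f2)).
rewrite /ev rmorphD rmorphM /= map_polyXn hornerD hornerM hornerXn coefDS.
by rewrite [_ * g ^+ _]mulrC coef_expM_small ?addr0.
Qed.

Lemma fps_compXn f g k : g 0%N = 0 -> (f ^+ k) \oS g = (f \oS g) ^+ k.
Proof.
move=> g0; elim: k => [|k IHk]; first by rewrite fps_comp1.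
by rewrite !exprS fps_compM ?IHk.
Qed.

Lemma coef0_fps_comp f g : (f \oS g) 0%N = f 0%N.
Proof. by rewrite /= big_ord1 expr0 mulr1. Qed.

(** Up to y^n, [f \oS g] is a polynomial in [g], through which substitution of [h] passes by
    additivity and multiplicativity. *)
Lemma fps_compA f g h : g 0%N = 0 -> h 0%N = 0 ->
  (f \oS g) \oS h = f \oS (g \oS h).
Proof.
move=> g0 h0; apply: fpsP => n.
transitivity (((\sum_(k < n.+1) fpsC (f k) * g ^+ k) \oS h) n).
  by apply: eq_bigr => k _; rewrite (@fps_comp_trunc _ _ _ n.+1).
rewrite (big_morph (fun u => u \oS h) (id1 := 0) (op1 := +%R)).
- rewrite (@fps_comp_trunc _ _ _ n.+1) ?coef0_fps_comp //.
  congr (fps_coef _ n); apply: eq_bigr => k _.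
  by rewrite fps_compM // fps_compC fps_compXn.
- by move=> u v; apply: fps_compD.
- by apply: fpsP => m /=; rewrite big1 // => i _; rewrite mul0r.
Qed.

Lemma fps_comp_X f : f \oS fpsX = f.
Proof.
have XnE k n : (fpsX ^+ k : fps R) n = (n == k)%:R.
  elim: k n => [|k IHk] n; first by rewrite expr0 coef1S; case: eqP.
  by rewrite exprS coefXMS; case: n => // n; rewrite IHk eqSS.
apply: fpsP => n /=; rewrite big_ord_recr /= XnE eqxx mulr1 big1 ?add0r // => k _.
by rewrite XnE gtn_eqF ?mulr0.
Qed.

Lemma fps_X_comp g : g 0%N = 0 -> fpsX \oS g = g.
Proof.
move=> g0; apply: fpsP => -[|n] /=; first by rewrite big_ord1 mul0r.
rewrite big_ord_recl mul0r add0r big_ord_recl mul1r expr1 big1 ?addr0 // => k _.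
by rewrite mul0r.
Qed.

End Composition.

Lemma fps_compV (R : comUnitRingType) (f g : fps R) : g 0%N = 0 ->
  f \is a GRing.unit -> f^-1 \oS g = (f \oS g)^-1.
Proof.
move=> g0 Uf.
have fV : (f^-1 \oS g) * (f \oS g) = 1 by rewrite -fps_compM // mulVr ?fps_comp1.
have Ufg : f \oS g \is a GRing.unit by rewrite fps_unitE coef0_fps_comp.
by apply: (mulIr Ufg); rewrite mulVr.
Qed.

(** * Existence of the compositional inverse *)

Section CompositionalInverse.
Variable F : fieldType.
Implicit Types f g h : fps F.

(* The equation [g \oS h = fpsX] is triangular linear in the coefficients of
   [g], with diagonal entries [(h ^+ n) n = h 1 ^+ n]. *)
Lemma fps_left_cinv h : delta_series h -> exists g, g \oS h = fpsX.
Proof.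
case=> h0; rewrite /= mulr1n => h1.
have hnn n : (h ^+ n) n = h 1%N ^+ n.
  elim: n => // n IHn; rewrite exprS coefMS big_ord_recl h0 mul0r add0r.
  rewrite big_ord_recl lift0 subSS subn0 IHn -exprS big1 ?addr0 // => i _.
  rewrite coef_expS_small ?mulr0 // !lift0 subSS ltn_subrL.
  exact: leq_ltn_trans (ltn_ord i).
pose next (s : seq F) : F :=
  (fpsX (size s) - \sum_(k < size s) s`_k * (h ^+ k) (size s)) / h 1%N ^+ size s.
pose pre n := iter n (fun s => rcons s (next s)) [::].
have szp n : size (pre n) = n by elim: n => //= n IHn; rewrite size_rcons IHn.
have preE n k : (k < n)%N -> (pre n)`_k = next (pre k).
  elim: n => // n IHn; rewrite ltnS leq_eqVlt /= nth_rcons szp => /orP[/eqP->|ltkn].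
    by rewrite ltnn eqxx.
  by rewrite ltkn IHn.
exists (Fps (fun n => next (pre n))); apply: fpsP => n.
rewrite /= big_ord_recr /= hnn {2}/next szp divfK ?expf_neq0 //.
rewrite addrC -addrA (_ : - _ + _ = 0) ?addr0 //; apply/eqP.
rewrite addrC subr_eq0; apply/eqP/eq_bigr => k _.
by rewrite preE.
Qed.

(** A left inverse [g] of [h] is again a delta series, so it has a left inverse [k]; associativity
    forces [k = h], which makes [g] two-sided. *)
Lemma fps_cinvP h : delta_series h ->
  [/\ fps_cinv h 0%N = 0, fps_cinv h \oS h = fpsX & h \oS fps_cinv h = fpsX].
Proof.
move=> hd; have [g gh] := fps_left_cinv hd; case: (hd) => h0 _.
have g0 : g 0%N = 0 by rewrite -(coef0_fps_comp g h) gh.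
have gd : delta_series g.
  split=> //; rewrite /= mulr1n; apply/eqP => g1.
  (* The coefficient of y in [g \oS h] is g_1 h_1, while that of [fpsX] is 1. *)
  move/(congr1 (fun f : fps F => f 1%N))/eqP: gh.
  by rewrite /= !big_ord_recl big_ord0 /= g0 g1 !mul0r !addr0 eq_sym oner_eq0.
have [k kg] := fps_left_cinv gd.
have kE : k = h by rewrite -(fps_comp_X k) -gh -fps_compA // kg fps_X_comp.
apply: (@xgetPex _ _ (fun g : fps F =>
  [/\ g 0%N = 0, g \oS h = fpsX & h \oS g = fpsX])).
by exists g; split; rewrite // -kE.
Qed.

End CompositionalInverse.

(** * The derivations y d/dy and d/dx *)

Section Derivations.

(* The constants of [delta] are only required to contain the image of [phi],
   so that [delta] may also be the derivation in the variable of S. *)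
Lemma fps_chain_rule (R S : comNzRingType) (phi : {rmorphism R -> S})
    (delta : {additive fps S -> fps S}) (e : fps R) (g : fps S) :
    (forall f1 f2, delta (f1 * f2) = delta f1 * f2 + f1 * delta f2) ->
    (forall c, delta (fpsC (phi c)) = 0) ->
    (forall (f1 f2 : fps S) n, f1 n = f2 n -> delta f1 n = delta f2 n) ->
    g 0%N = 0 ->
  delta (fps_map phi e \oS g) = (fps_map phi e^`S \oS g) * delta g.
Proof.
move=> dM dC dloc g0.
have dX k : delta (g ^+ k.+1) = (g ^+ k * delta g) *+ k.+1.
  elim: k => [|k IHk]; first by rewrite expr1 expr0 mul1r.
  by rewrite exprS dM IHk mulrnAr mulrA -exprS [delta g * _]mulrC -mulrS.
apply: fpsP => n; rewrite coef_fps_compM //.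
(* Locality lets [delta] act on a finite sum. The bound [n.+2] leaves [n.+1] terms once the constant
   one is killed, as many as on the right. *)
rewrite (dloc _ _ _ (fps_comp_trunc _ g0 (ltnW (ltnSn n.+1)))).
rewrite raddf_sum coef_sumS big_ord_recl expr0 mulr1 dC add0r.
apply: eq_bigr => k _; rewrite dM dC mul0r add0r lift0 dX coefCM.
have -> : fps_map phi e^`S k = phi (e k.+1) *+ k.+1 by rewrite /= rmorphMn.
rewrite [RHS]mulrnAl -[RHS]mulrnAr; congr (_ * _).
by elim: k.+1 => // m IHm; rewrite !mulrS coefDS IHm.
Qed.

(** Apply the Leibniz rule to f f^-1 = 1; that [delta] kills 1 comes from the same rule for 1 *
    1. *)
Lemma fps_derivationV (R : comUnitRingType) (delta : fps R -> fps R) f :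
    (forall f1 f2, delta (f1 * f2) = delta f1 * f2 + f1 * delta f2) ->
    f \is a GRing.unit ->
  delta f^-1 = - (delta f / f ^+ 2).
Proof.
move=> dM Uf.
have d1 : delta 1 = 0.
  by apply: (@addrI _ (delta 1)); rewrite addr0 -[in RHS](mulr1 1) dM mulr1 mul1r.
have := dM f f^-1; rewrite divrr // d1 => /esym/eqP; rewrite addrC addr_eq0 => /eqP E.
by rewrite -[LHS](mulKr Uf) E mulrN mulrCA expr2 invrM.
Qed.

(** The operator y d/dy. Unlike d/dy it keeps indices, as the locality hypothesis of
    [fps_chain_rule] demands. *)
Definition fps_euler (R : nzRingType) (f : fps R) : fps R :=
  Fps (fun n => f n *+ n).

Lemma fps_euler_is_zmod_morphism (R : nzRingType) :
  zmod_morphism (@fps_euler R).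
Proof. by move=> f g; apply: fpsP => n /=; rewrite mulrnBl. Qed.

HB.instance Definition _ (R : nzRingType) := GRing.isZmodMorphism.Build
  (fps R) (fps R) (@fps_euler R) (@fps_euler_is_zmod_morphism R).

Lemma fps_eulerE (R : nzRingType) (f : fps R) : fps_euler f = fpsX * f^`S.
Proof. by apply: fpsP => -[|n]; rewrite coefXMS. Qed.

Lemma fps_eulerM (R : nzRingType) (f g : fps R) :
  fps_euler (f * g) = fps_euler f * g + f * fps_euler g.
Proof.
apply: fpsP => n; rewrite coefDS !coefMS /= -sumrMnl -big_split.
by apply: eq_bigr => i _; rewrite /= mulrnAl mulrnAr -mulrnDr subnKC ?leq_ord.
Qed.

Lemma fps_eulerC (R : nzRingType) (c : R) : fps_euler (fpsC c) = 0.
Proof. by apply: fpsP => -[|n]; rewrite //= mul0rn. Qed.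

Lemma fps_euler_map (R S : nzRingType) (phi : {rmorphism R -> S}) f :
  fps_euler (fps_map phi f) = fps_map phi (fps_euler f).
Proof. by apply: fpsP => n /=; rewrite rmorphMn. Qed.

Lemma fps_euler_comp (R S : comNzRingType) (phi : {rmorphism R -> S})
    (e : fps R) (g : fps S) : g 0%N = 0 ->
  fps_euler (fps_map phi e \oS g) = (fps_map phi e^`S \oS g) * fps_euler g.
Proof.
apply: fps_chain_rule => [f1 f2|c|f1 f2 n /= ->//]; first exact: fps_eulerM.
exact: fps_eulerC.
Qed.

(** The operator d/dx, where x is the variable of the coefficients. *)
Definition fps_coef_deriv (R : nzRingType) (f : fps {poly R}) : fps {poly R} :=
  Fps (fun n => (f n)^`()).

Lemma fps_coef_deriv_is_zmod_morphism (R : nzRingType) :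
  zmod_morphism (@fps_coef_deriv R).
Proof. by move=> f g; apply: fpsP => n /=; rewrite derivB. Qed.

HB.instance Definition _ (R : nzRingType) := GRing.isZmodMorphism.Build
  (fps {poly R}) (fps {poly R}) (@fps_coef_deriv R)
  (@fps_coef_deriv_is_zmod_morphism R).

Lemma fps_coef_derivM (R : comNzRingType) (f g : fps {poly R}) :
  fps_coef_deriv (f * g) = fps_coef_deriv f * g + f * fps_coef_deriv g.
Proof.
apply: fpsP => n; rewrite coefDS !coefMS /= raddf_sum -big_split.
by apply: eq_bigr => i _; rewrite /= derivM.
Qed.

Lemma fps_coef_deriv_map (R : nzRingType) (f : fps R) :
  fps_coef_deriv (fps_map polyC f) = 0.
Proof. by apply: fpsP => n /=; rewrite derivC. Qed.

Lemma fps_coef_deriv_comp (R : comNzRingType) (e : fps R)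
    (g : fps {poly R}) : g 0%N = 0 ->
  fps_coef_deriv (fps_map polyC e \oS g)
  = (fps_map polyC e^`S \oS g) * fps_coef_deriv g.
Proof.
apply: fps_chain_rule => [f1 f2|c|f1 f2 n /= ->//]; first exact: fps_coef_derivM.
by apply: fpsP => -[|n] /=; rewrite ?derivC ?deriv0.
Qed.

End Derivations.

(** * The inverse series and the prefactor under y d/dy *)

Section ShefferAppell.
Variables (F : numFieldType) (l h : fps F).
Hypotheses (h_delta : delta_series h) (l_inv : invertible_series l).

Let f := fps_cinv h.
Let f0 : f 0%N = 0. Proof. by case: (fps_cinvP h_delta). Qed.
Let hf : h \oS f = fpsX. Proof. by case: (fps_cinvP h_delta). Qed.

Let Ul : l \is a GRing.unit. Proof. by rewrite fps_unitE unitfE. Qed.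
Let Uh' : h^`S \is a GRing.unit.
Proof. by rewrite fps_unitE unitfE; case: h_delta. Qed.
Let Ulf : l \oS f \is a GRing.unit.
Proof. by rewrite fps_unitE coef0_fps_comp. Qed.
Let Uh'f : h^`S \oS f \is a GRing.unit.
Proof. by rewrite fps_unitE coef0_fps_comp. Qed.

Lemma fps_exp_deriv : (fps_exp : fps F)^`S = fps_exp.
Proof.
apply: fpsP => n /=; rewrite factS natrM invfM -[LHS]mulr_natl mulrA divff ?mul1r //.
by rewrite pnatr_eq0.
Qed.

Let euler_compF (e g : fps F) : g 0%N = 0 ->
  fps_euler (e \oS g) = (e^`S \oS g) * fps_euler g.
Proof.
move=> g0; have mapid (u : fps F) : fps_map idfun u = u by apply: fpsP.
by have := fps_euler_comp idfun e g0; rewrite !mapid.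
Qed.

(** Applying y d/dy to h(f(y)) = y gives h'(f) y f' = y, and this y is h(f). *)
Lemma fps_euler_cinv : fps_euler f = (h / h^`S) \oS f.
Proof.
have := euler_compF h f0; rewrite hf.
have -> : fps_euler (fpsX : fps F) = fpsX.
  by apply: fpsP => -[|[|n]] /=; rewrite ?mulr1n ?mul0rn.
by rewrite fps_compM // fps_compV // hf => XE; rewrite {1}XE mulrAC mulrV // mul1r.
Qed.

Let prefactor : fps F := ((l \oS f) * l)^-1.

(** Logarithmic derivative: the factor l(y) yields the term of [sheffer_b] and the factor l(f(y))
    that of [sheffer_c]. *)
Lemma fps_euler_prefactor :
  fps_euler prefactor
  = prefactor * ((- ((h * (l^`S \oS h)) / (l \oS h))
                  - ((h * l^`S) / (h^`S * l))) \oS f).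
Proof.
have h0 : h 0%N = 0 by case: h_delta.
have Uh'l : h^`S * l \is a GRing.unit by rewrite unitrM Uh'.
have Ulh : l \oS h \is a GRing.unit by rewrite fps_unitE coef0_fps_comp.
rewrite fps_compD !fps_compN !(fps_compM _ _ f0) !fps_compV //.
rewrite (fps_compM _ _ f0) !fps_compA // hf !fps_comp_X.
rewrite (fps_derivationV (@fps_eulerM F)) ?unitrM ?Ulf ?Ul //.
rewrite fps_eulerM euler_compF // fps_euler_cinv fps_compM // fps_compV // hf.
rewrite fps_eulerE /prefactor.
rewrite !invrM ?unitrX ?unitrM ?Ulf ?Ul ?Uh'f //.
have EL := mulrV Ul; have ELf := mulrV Ulf.
move: EL ELf; move: (l^-1) ((l \oS f)^-1) ((h^`S \oS f)^-1) => m q r EL ELf.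
set u := l^`S \oS f; set v := l^`S; set L := l in EL *; set M := l \oS f in ELf *.
(* With the inverses generalized to atoms, the products [L * m] and [M * q] are isolated so that
   they can be rewritten to 1. *)
transitivity (- (u * (fpsX * r) * (L * m) * m * q ^+ 2)
              - (M * q) * q * fpsX * v * m ^+ 2).
  ring.
rewrite EL ELf; ring.
Qed.

(** * Differential equations of the generating function *)

Variable A : nat -> {poly F}.
Hypothesis hA : sheffer_appell l h A.

Let G : fps {poly F} := Fps (fun n => (n`!%:R)^-1 *: A n).
Let xf : fps {poly F} := fpsC 'X * fps_map polyC f.
Let xf0 : xf 0%N = 0. Proof. by rewrite /xf coefCM /= f0 mulr0. Qed.
Let GE : G = fps_map polyC prefactor * (fps_map polyC fps_exp \oS xf).
Proof. by rewrite /G -hA. Qed.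

(** Only the exponential depends on x, and the x-derivative of its argument x f is f. *)
Lemma fps_coef_deriv_sheffer : fps_coef_deriv G = fps_map polyC f * G.
Proof.
rewrite GE fps_coef_derivM fps_coef_deriv_map mul0r add0r.
rewrite fps_coef_deriv_comp // fps_exp_deriv.
rewrite fps_coef_derivM fps_coef_deriv_map mulr0 addr0.
have -> : fps_coef_deriv (fpsC 'X) = 1 :> fps {poly F}.
  by apply: fpsP => -[|n] /=; rewrite ?derivX ?deriv0.
by rewrite mul1r; ring.
Qed.

(** The powers of f are constant in x, so they commute with d/dx and dG/dx = f G can be iterated. *)
Lemma coef_fps_map_expM_sheffer k n :
  (fps_map polyC f ^+ k * G) n = (n`!%:R)^-1 *: (A n)^`(k).
Proof.
suff -> : fps_map polyC f ^+ k * G = Fps (fun n => (G n)^`(k)).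
  by rewrite /= derivnZ.
elim: k => [|k IHk]; first by rewrite mul1r.
have dX : fps_coef_deriv (fps_map polyC f ^+ k) = 0.
  by rewrite -rmorphXn fps_coef_deriv_map.
rewrite exprSr -mulrA -fps_coef_deriv_sheffer.
have := fps_coef_derivM (fps_map polyC f ^+ k) G.
by rewrite dX mul0r add0r => <-; rewrite IHk; apply: fpsP.
Qed.

Lemma coef_fps_map_compM_sheffer (s : fps F) n :
  (fps_map polyC (s \oS f) * G) n
  = (n`!%:R)^-1 *: \sum_(k < n.+1) (s k)%:P * (A n)^`(k).
Proof.
rewrite fps_map_comp coef_fps_compM; last by rewrite /= f0.
rewrite scaler_sumr; apply: eq_bigr => k _.
by rewrite coef_fps_map_expM_sheffer scalerAr.
Qed.

Lemma fps_euler_sheffer :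
  fps_euler G = fpsC 'X * (fps_map polyC ((h / h^`S) \oS f) * G)
    + fps_map polyC ((- ((h * (l^`S \oS h)) / (l \oS h))
                      - ((h * l^`S) / (h^`S * l))) \oS f) * G.
Proof.
rewrite GE fps_eulerM fps_euler_map fps_euler_prefactor rmorphM /=.
rewrite fps_euler_comp // fps_exp_deriv fps_eulerM fps_eulerC mul0r add0r.
rewrite fps_euler_map fps_euler_cinv; ring.
Qed.

Lemma sheffer_appell_differential_equation n :
  \sum_(k < n.+1)
     ('X * (sheffer_a h k)%:P + (sheffer_b l h k)%:P + (sheffer_c l h k)%:P)
       * ((k`!%:R)^-1 *: (A n)^`(k))
  - n%:R * A n = 0.
Proof.
have nf0 m : m`!%:R != 0 :> F by rewrite pnatr_eq0 -lt0n fact_gt0.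
(* Compare coefficients of y^n in the equation for y dG/dy; both sides carry the nonzero factor
   1/n!, which is cancelled. *)
have : (n`!%:R)^-1 *: A n *+ n = fps_euler G n by [].
rewrite fps_euler_sheffer coefDS coefCM !coef_fps_map_compM_sheffer.
rewrite -scalerAr -scalerDr scalerMnr => /(scalerI (invr_neq0 (nf0 n))) E.
apply/eqP; rewrite subr_eq0 mulr_natl E mulr_sumr -big_split; apply/eqP.
apply: eq_bigr => k _.
rewrite /sheffer_a /sheffer_b /sheffer_c !fps_derivn_at0E coefDS.
set b := fps_coef (- (_ / (l \oS h))) k; set c := fps_coef (- _) k.
(* The k! produced by the k-th derivative at 0 absorbs the 1/k! of the equation. *)
have kfK (u : F) p : (u *+ k`!)%:P * ((k`!%:R)^-1 *: p) = u%:P * p.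
  by rewrite -scalerAr scalerAl -mul_polyC -polyCM -[u *+ _]mulr_natl
     mulrA mulVf ?mul1r.
rewrite !mulrDl -mulrA !kfK polyCD /=; ring.
Qed.

End ShefferAppell.

Theorem theorem1 (R : realType) (l h : fps R[i]) (A : nat -> {poly R[i]})
    (h_delta : delta_series h) (l_inv : invertible_series l)
    (hA : sheffer_appell l h A) (n : nat) :
  \sum_(k < n.+1)
     ('X * (sheffer_a h k)%:P + (sheffer_b l h k)%:P + (sheffer_c l h k)%:P)
       * ((k`!%:R)^-1 *: (A n)^`(k))
  - n%:R * A n = 0.
Proof. exact: sheffer_appell_differential_equation. Qed.
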